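(* Let $A,B\in\mathbb{C}^{m\times n}$. The following conditions are equivalent: (a) $A\leq^\diamond B$. (b) $B^\dagger B A^\dagger A=A^\dagger B A^\dagger A=A^\dagger A$ and $AA^\dagger BB^\dagger=AA^\dagger BA^\dagger=AA^\dagger$. (c) $B^\dagger B A^{\dagger-}=A^\dagger B A^{\dagger-}=A^{\dagger-}$ and $A^{-\dagger}BB^\dagger=A^{-\dagger}BA^\dagger=A^{-\dagger}$ for some $A^-\in\mathcal{A}\{1\}$. (d) $B^\dagger B A^{\dagger-}=A^\dagger B A^{\dagger-}=A^{\dagger-}$ and $A^{-\dagger}BB^\dagger=A^{-\dagger}BA^\dagger=A^{-\dagger}$ for all $A^-\in\mathcal{A}\{1\}$.
   Context: $A^*$ is the conjugate transpose, $\mathcal{R}(\cdot)$ the range (column space), and $A^\dagger\in\mathbb{C}^{n\times m}$ the Moore-Penrose inverse of $A\in\mathbb{C}^{m\times n}$. The set of inner inverses of $A$ is $\mathcal{A}\{1\}=\{X\in\mathbb{C}^{n\times m}: AXA=A\}$. For $A^-\in\mathcal{A}\{1\}$, the associated 1MP-inverse and MP1-inverse of $A$ are $A^{-\dagger}:=A^-AA^\dagger$ and $A^{\dagger-}:=A^\dagger AA^-$, respectively. The diamond partial order on $\mathbb{C}^{m\times n}$ is defined by: $A\leq^\diamond B$ iff $\mathcal{R}(A)\subseteq\mathcal{R}(B)$, $\mathcal{R}(A^* )\subseteq\mathcal{R}(B^* )$ and $AB^*A=AA^*A$. *)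

(* Defs.v *)
From mathcomp Require Import all_boot all_order all_algebra.
From mathcomp Require Import classical_sets.

Set Implicit Arguments.
Unset Strict Implicit.
Unset Printing Implicit Defensive.

Import GRing.Theory Num.Theory.

Local Open Scope ring_scope.
Local Open Scope sesquilinear_scope.
Local Open Scope classical_set_scope.

Lemma adjmxM (C : numClosedFieldType) m n p (A : 'M[C]_(m, n))
  (B : 'M[C]_(n, p)) : (A *m B) ^t* = B ^t* *m A ^t*.
Proof. by rewrite trmx_mul map_mxM. Qed.

(* The four Penrose equations, as a boolean so that xchoose applies below. *)
Definition penrose (C : numClosedFieldType) m n (A : 'M[C]_(m, n))
  (X : 'M[C]_(n, m)) : bool :=
  [&& A *m X *m A == A, X *m A *m X == X,
      (A *m X) ^t* == A *m X & (X *m A) ^t* == X *m A].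

Lemma penrose_uniq (C : numClosedFieldType) m n (A : 'M[C]_(m, n))
  (X Y : 'M[C]_(n, m)) : penrose A X -> penrose A Y -> X = Y.
Proof.
case/and4P=> /eqP AXA /eqP XAX /eqP hAX /eqP hXA.
case/and4P=> /eqP AYA /eqP YAY /eqP hAY /eqP hYA.
have eAX : A *m X = A *m Y.
  rewrite -hAX -{1}AYA -(mulmxA _ A X) adjmxM hAX hAY.
  by rewrite mulmxA AXA.
have eXA : X *m A = Y *m A.
  rewrite -hXA -{1}AYA -(mulmxA A Y A) (mulmxA X A) adjmxM hXA hYA.
  by rewrite -mulmxA (mulmxA A) AXA.
by rewrite -XAX eXA -mulmxA eAX mulmxA YAY.
Qed.

Lemma gram_unitmx (C : numClosedFieldType) r n (F : 'M[C]_(r, n)) :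
  row_free F -> F *m F ^t* \in unitmx.
Proof.
move=> Ffree; rewrite -row_free_unit -kermx_eq0; apply/rowV0P => u.
move/sub_kermxP => uG; apply/eqP; rewrite -(mulmx_free_eq0 _ Ffree).
have dot0 : dotmx (u *m F) (u *m F) = 0.
  by rewrite dotmxE adjmxM mulmxA -(mulmxA u) uG mul0mx mxE.
by rewrite -(dnorm_eq0 (@dotmx C n)); apply/eqP.
Qed.

Lemma penrose_full_rank (C : numClosedFieldType) m n r (E : 'M[C]_(m, r))
  (F : 'M[C]_(r, n)) (G := F *m F ^t*) (H := E ^t* *m E) :
  row_full E -> row_free F ->
  penrose (E *m F) (F ^t* *m invmx G *m invmx H *m E ^t*).
Proof.
move=> Efull Ffree; set X := _ *m E ^t*.
have tK k l (M : 'M[C]_(k, l)) : M ^t* ^t* = M.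
  by apply/matrixP => i j; rewrite !mxE conjCK.
have Gu : G \in unitmx by apply: gram_unitmx.
have Hu : H \in unitmx.
  rewrite /H -{2}(tK _ _ E); apply: gram_unitmx.
  by rewrite /row_free mxrank_map mxrank_tr.
have hG : G ^t* = G by rewrite adjmxM tK.
have hH : H ^t* = H by rewrite adjmxM tK.
have hV k (M : 'M[C]_k) : M ^t* = M -> (invmx M) ^t* = invmx M.
  by move=> hM; rewrite trmx_inv map_invmx hM.
have AX : E *m F *m X = E *m invmx H *m E ^t*.
  by rewrite /X !mulmxA -(mulmxA E F) mulmxK.
have XA : X *m (E *m F) = F ^t* *m invmx G *m F.
  by rewrite /X !mulmxA -(mulmxA _ (E ^t*) E) mulmxKV.
apply/and4P; split; apply/eqP.
- by rewrite AX !mulmxA -(mulmxA _ (E ^t*) E) mulmxKV.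
- by rewrite XA /X !mulmxA -(mulmxA _ F (F ^t*)) mulmxKV.
- by rewrite AX !adjmxM tK hV // mulmxA.
- by rewrite XA !adjmxM tK hV // mulmxA.
Qed.

Lemma penrose_exists (C : numClosedFieldType) m n (A : 'M[C]_(m, n)) :
  exists X, penrose A X.
Proof.
by rewrite -(mulmx_base A); eexists; apply: penrose_full_rank;
  [exact: col_base_full | exact: row_base_free].
Qed.

(* Moore-Penrose inverse; not MathComp's pinvmx, which is an inner inverse
   that satisfies no Hermitian condition in general. *)
Definition mpinv (C : numClosedFieldType) m n (A : 'M[C]_(m, n)) :
  'M[C]_(n, m) := xchoose (penrose_exists A).

Lemma mpinvP (C : numClosedFieldType) m n (A : 'M[C]_(m, n)) :
  penrose A (mpinv A).
Proof. exact: xchooseP. Qed.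

Definition inner_inverses (C : numClosedFieldType) m n (A : 'M[C]_(m, n)) :
  set 'M[C]_(n, m) := [set X | A *m X *m A = A].

Definition inv1MP (C : numClosedFieldType) m n (A : 'M[C]_(m, n))
  (Am : 'M[C]_(n, m)) : 'M[C]_(n, m) := Am *m A *m mpinv A.

Definition invMP1 (C : numClosedFieldType) m n (A : 'M[C]_(m, n))
  (Am : 'M[C]_(n, m)) : 'M[C]_(n, m) := mpinv A *m A *m Am.

Definition colrange (C : numClosedFieldType) m n (A : 'M[C]_(m, n)) :
  set 'cV[C]_m := range (fun x : 'cV[C]_n => A *m x).

Definition diamond_le (C : numClosedFieldType) m n (A B : 'M[C]_(m, n)) :
  Prop :=
  [/\ colrange A `<=` colrange B,
      colrange (A ^t*) `<=` colrange (B ^t*) &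
      A *m B ^t* *m A = A *m A ^t* *m A].

(* Main.v *)
(** All four conditions say the same thing: [B *m mpinv B] fixes [A] on the left,
    [mpinv B *m B] fixes it on the right, and [mpinv A] is an outer inverse
    compatible with [B], [mpinv A *m B *m mpinv A = mpinv A].  The two fixing
    equations are the range inclusions; the third is [A B* A = A A* A] because
    [A*] and [mpinv A] have the same range and the same kernel.  Multiplying by
    [A], [mpinv A] or any inner inverse of [A] on the appropriate side passes
    between these equations and those on projectors or 1MP- and MP1-inverses. *)
Require Import Defs.
From mathcomp Require Import all_boot all_order all_algebra.
From mathcomp Require Import classical_sets reals.
From mathcomp Require Import complex.

Local Open Scope ring_scope.
Local Open Scope complex_scope.

Section DiamondOrder.
Local Open Scope sesquilinear_scope.
Local Open Scope classical_set_scope.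
Context {C : numClosedFieldType}.

Lemma adjmxK {m n} (A : 'M[C]_(m, n)) : A ^t* ^t* = A.
Proof. by apply/matrixP => i j; rewrite !mxE Num.Theory.conjCK. Qed.

Lemma mpinv_inner {m n} (A : 'M[C]_(m, n)) : A *m mpinv A *m A = A.
Proof. by case/and4P: (mpinvP A) => /eqP. Qed.

Lemma mpinv_outer {m n} (A : 'M[C]_(m, n)) : mpinv A *m A *m mpinv A = mpinv A.
Proof. by case/and4P: (mpinvP A) => _ /eqP. Qed.

Lemma adj_mulmx_mpinv {m n} (A : 'M[C]_(m, n)) :
  (A *m mpinv A) ^t* = A *m mpinv A.
Proof. by case/and4P: (mpinvP A) => _ _ /eqP. Qed.

Lemma adj_mulmpinv_mx {m n} (A : 'M[C]_(m, n)) :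
  (mpinv A *m A) ^t* = mpinv A *m A.
Proof. by case/and4P: (mpinvP A) => _ _ _ /eqP. Qed.

Lemma adj_mulmx_mpinvA {m n} (A : 'M[C]_(m, n)) :
  A ^t* *m (A *m mpinv A) = A ^t*.
Proof. by rewrite -[in RHS](mpinv_inner A) adjmxM adj_mulmx_mpinv. Qed.

Lemma mulmpinv_mx_adj {m n} (A : 'M[C]_(m, n)) :
  mpinv A *m A *m A ^t* = A ^t*.
Proof. by rewrite -[in RHS](mpinv_inner A) -(mulmxA A) adjmxM adj_mulmpinv_mx. Qed.

(** Rewriting a Hermitian projector as its own adjoint exposes a factor [A ^t*] inside [mpinv A].
    This lemma and the next let [A ^t*] be traded for [mpinv A] on either side of a product. *)
Lemma mpinv_factorl {m n} (A : 'M[C]_(m, n)) :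
  mpinv A *m (mpinv A) ^t* *m A ^t* = mpinv A.
Proof. by rewrite -mulmxA -adjmxM adj_mulmx_mpinv mulmxA mpinv_outer. Qed.

Lemma mpinv_factorr {m n} (A : 'M[C]_(m, n)) :
  A ^t* *m (mpinv A) ^t* *m mpinv A = mpinv A.
Proof. by rewrite -adjmxM adj_mulmpinv_mx mpinv_outer. Qed.

Lemma sub_colrangeP {m n p} (A : 'M[C]_(m, n)) (B : 'M[C]_(m, p)) :
  colrange A `<=` colrange B <-> exists X, A = B *m X.
Proof.
split=> [sAB | [X ->] _ [x _ <-]]; last by exists (X *m x); rewrite ?mulmxA.
have imB j : exists x, B *m x == col j A.
  have [|x _ Bx] := sAB (col j A); last by exists x; apply/eqP.
  by exists (delta_mx j 0); rewrite ?colE.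
(* The factor is assembled column by column from chosen preimages of the columns of [A]. *)
exists (\matrix_(i, j) xchoose (imB j) i 0); apply/matrixP => i j.
have /eqP/colP/(_ i) := xchooseP (imB j); rewrite !mxE => <-.
by apply: eq_bigr => k _; rewrite mxE.
Qed.

Lemma sub_colrange_mpinv {m n p} (A : 'M[C]_(m, n)) (B : 'M[C]_(m, p)) :
  colrange A `<=` colrange B <-> B *m mpinv B *m A = A.
Proof.
split=> [/sub_colrangeP[X ->] | BA]; first by rewrite mulmxA mpinv_inner.
by apply/sub_colrangeP; exists (mpinv B *m A); rewrite mulmxA.
Qed.

Lemma sub_rowrange_mpinv {m n p} (A : 'M[C]_(m, n)) (B : 'M[C]_(p, n)) :
  colrange (A ^t*) `<=` colrange (B ^t*) <-> A *m (mpinv B *m B) = A.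
Proof.
split=> [/sub_colrangeP[X AX] | AB].
  by rewrite -(adjmxK A) AX adjmxM adjmxK -!mulmxA (mulmxA B) mpinv_inner.
apply/sub_colrangeP; exists ((A *m mpinv B) ^t*).
by rewrite -adjmxM -mulmxA AB.
Qed.

Lemma diamond_eq_mpinv {m n} (A B : 'M[C]_(m, n)) :
  A *m B ^t* *m A = A *m A ^t* *m A <-> mpinv A *m B *m mpinv A = mpinv A.
Proof.
split=> [ABA | PBP].
  have adjABA : A ^t* *m B *m A ^t* = A ^t* *m A *m A ^t*.
    by have /(congr1 (fun M => M ^t*)) := ABA; rewrite !adjmxM !adjmxK !mulmxA.
  set P := mpinv A.
  (* The outer factors absorb both copies of [A ^t*] and leave [P]; with [A] in place of [B] the
     same product is [P *m A *m P]. *)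
  transitivity (P *m P ^t* *m (A ^t* *m B *m A ^t*) *m P ^t* *m P).
    by rewrite !mulmxA mpinv_factorl -!(mulmxA (P *m B)) mpinv_factorr.
  rewrite adjABA !mulmxA mpinv_factorl -!(mulmxA (P *m A)) mpinv_factorr.
  exact: mpinv_outer.
suff adjABA : A ^t* *m B *m A ^t* = A ^t* *m A *m A ^t*.
  have /(congr1 (fun M => M ^t*)) := adjABA.
  by rewrite !adjmxM !adjmxK !mulmxA.
set P := mpinv A in PBP *.
(* The reverse trade: [A ^t* *m A *m P] and [P *m A *m A ^t*] both collapse to [A ^t*]. *)
transitivity (A ^t* *m A *m (P *m B *m P) *m A *m A ^t*).
  rewrite !mulmxA -(mulmxA (A ^t*) A) adj_mulmx_mpinvA.
  by rewrite -!(mulmxA (A ^t* *m B)) mulmpinv_mx_adj.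
by rewrite PBP -(mulmxA (A ^t*) A P) adj_mulmx_mpinvA.
Qed.

Definition diamond_mpinv {m n} (A B : 'M[C]_(m, n)) : Prop :=
  [/\ B *m mpinv B *m A = A, A *m (mpinv B *m B) = A
    & mpinv A *m B *m mpinv A = mpinv A].

Lemma diamond_leP {m n} (A B : 'M[C]_(m, n)) :
  diamond_le A B <-> diamond_mpinv A B.
Proof.
by split=> -[/sub_colrange_mpinv ? /sub_rowrange_mpinv ? /diamond_eq_mpinv ?].
Qed.

(** Both projectors are Hermitian, so taking adjoints reverses the order of their product;
    multiplying on the left by [mpinv A] or by [A] then passes between [A] and its projector. *)
Lemma mulmpinv_mx_fixP {m n p} (A : 'M[C]_(m, n)) (B : 'M[C]_(p, n)) :
  A *m (mpinv B *m B) = A <-> mpinv B *m B *m (mpinv A *m A) = mpinv A *m A.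
Proof.
split=> [AB | BA].
  by rewrite -(adj_mulmpinv_mx B) -(adj_mulmpinv_mx A) -adjmxM -mulmxA AB.
have {}BA : mpinv A *m A *m (mpinv B *m B) = mpinv A *m A.
  by rewrite -(adj_mulmpinv_mx B) -(adj_mulmpinv_mx A) -adjmxM BA.
by rewrite -{1}(mpinv_inner A) -(mulmxA A) -mulmxA BA mulmxA mpinv_inner.
Qed.

Lemma mulmx_mpinv_fixP {m n p} (A : 'M[C]_(m, n)) (B : 'M[C]_(m, p)) :
  B *m mpinv B *m A = A <-> A *m mpinv A *m (B *m mpinv B) = A *m mpinv A.
Proof.
split=> [BA | AB].
  by rewrite -(adj_mulmx_mpinv B) -(adj_mulmx_mpinv A) -adjmxM mulmxA BA.
have {}AB : B *m mpinv B *m (A *m mpinv A) = A *m mpinv A.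
  by rewrite -(adj_mulmx_mpinv B) -(adj_mulmx_mpinv A) -adjmxM AB.
by rewrite -{1}(mpinv_inner A) mulmxA AB mpinv_inner.
Qed.

Lemma diamond_projectorsP {m n} (A B : 'M[C]_(m, n)) :
  diamond_mpinv A B <->
  [/\ mpinv B *m B *m mpinv A *m A = mpinv A *m B *m mpinv A *m A,
      mpinv A *m B *m mpinv A *m A = mpinv A *m A,
      A *m mpinv A *m B *m mpinv B = A *m mpinv A *m B *m mpinv A
    & A *m mpinv A *m B *m mpinv A = A *m mpinv A].
Proof.
split=> [[/mulmx_mpinv_fixP AB /mulmpinv_mx_fixP BA PBP] | [e1 e2 e3 e4]].
  rewrite PBP -(mulmxA _ (mpinv A) A) BA -(mulmxA _ B (mpinv B)) AB.
  by rewrite -!mulmxA (mulmxA (mpinv A)) PBP.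
split.
- by apply/mulmx_mpinv_fixP; rewrite mulmxA e3.
- by apply/mulmpinv_mx_fixP; rewrite mulmxA e1.
(* Expanding the right-hand [mpinv A] creates the product on which [e2] acts. *)
- by rewrite -{2}(mpinv_outer A) !mulmxA e2 mpinv_outer.
Qed.

(** Multiplying by [Am] on the outer side turns the projector equations into these, and multiplying
    by [A] there undoes it because [A *m Am *m A = A]. The left-hand condition is free of [Am],
    which is what makes one inner inverse as good as all. *)
Lemma diamond_invMP1P {m n} (A B : 'M[C]_(m, n)) (Am : 'M[C]_(n, m)) :
  inner_inverses A Am ->
  diamond_mpinv A B <->
  [/\ mpinv B *m B *m invMP1 A Am = mpinv A *m B *m invMP1 A Am,
      mpinv A *m B *m invMP1 A Am = invMP1 A Am,
      inv1MP A Am *m B *m mpinv B = inv1MP A Am *m B *m mpinv A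
    & inv1MP A Am *m B *m mpinv A = inv1MP A Am].
Proof.
move=> AmA; have {}AmA : A *m Am *m A = A by [].
have MP1A : invMP1 A Am *m A = mpinv A *m A.
  by rewrite /invMP1 -!mulmxA (mulmxA A) AmA.
rewrite diamond_projectorsP; split=> [[e1 e2 e3 e4] | [e1 e2 e3 e4]].
  rewrite /invMP1 /inv1MP !mulmxA e1 e2.
  by rewrite -!(mulmxA Am) e3 e4.
have := (congr1 (mulmx^~ A) e1, congr1 (mulmx^~ A) e2,
         congr1 (mulmx A) e3, congr1 (mulmx A) e4).
rewrite -!(mulmxA _ (invMP1 A Am)) MP1A !mulmxA AmA.
by case=> -[[]].
Qed.

End DiamondOrder.

Theorem theorem3p1 (R : realType) (m n : nat) (A B : 'M[R[i]]_(m, n)) :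
  [<-> diamond_le A B;
       [/\ mpinv B *m B *m mpinv A *m A = mpinv A *m B *m mpinv A *m A,
           mpinv A *m B *m mpinv A *m A = mpinv A *m A,
           A *m mpinv A *m B *m mpinv B = A *m mpinv A *m B *m mpinv A &
           A *m mpinv A *m B *m mpinv A = A *m mpinv A];
       exists2 Am : 'M[R[i]]_(n, m), inner_inverses A Am &
         [/\ mpinv B *m B *m invMP1 A Am = mpinv A *m B *m invMP1 A Am,
             mpinv A *m B *m invMP1 A Am = invMP1 A Am,
             inv1MP A Am *m B *m mpinv B = inv1MP A Am *m B *m mpinv A &
             inv1MP A Am *m B *m mpinv A = inv1MP A Am];
       forall Am : 'M[R[i]]_(n, m), inner_inverses A Am ->
         [/\ mpinv B *m B *m invMP1 A Am = mpinv A *m B *m invMP1 A Am,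
             mpinv A *m B *m invMP1 A Am = invMP1 A Am,
             inv1MP A Am *m B *m mpinv B = inv1MP A Am *m B *m mpinv A &
             inv1MP A Am *m B *m mpinv A = inv1MP A Am]].
Proof.
tfae.
- by move/diamond_leP/diamond_projectorsP.
- move/diamond_projectorsP => AB; exists (mpinv A); first exact: mpinv_inner.
  exact/(diamond_invMP1P _ _ _ (mpinv_inner A)).
(* The passage from [X] to an arbitrary [Y] goes through [diamond_mpinv A B]. *)
- by case=> X AX /(diamond_invMP1P _ _ _ AX) AB Y AY; apply/diamond_invMP1P.
- move=> /(_ _ (mpinv_inner A)) AB.
  exact/diamond_leP/(diamond_invMP1P _ _ _ (mpinv_inner A)).
Qed.
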